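(* Let $G$ be a group and let $X$ be a generating set of $G$. Suppose that the Cayley graph $\Gamma(G,X)$ is hyperbolic and acylindrical. Then there exists a constant $N_1>0$ such that for any loxodromic (with respect to $X$) element $c\in G$, for any elliptic (with respect to $X$) element $e\in G\setminus E_G(c)$, and for any $n\in\mathbb{N}$ we have $$|c^ne|_X>\frac{n}{N_1}.$$
   Context: Generating sets are symmetric and may be infinite. $\mathbb{N}$ denotes the positive integers. $|g|_X$ is the length of a shortest word in $X$ representing $g$. $\Gamma(G,X)$ is acylindrical if the left action of $G$ on it is acylindrical, i.e. for every $\varepsilon>0$ there exist $R,N>0$ such that for any points $x,y$ with $d(x,y)\geqslant R$ there are at most $N$ elements $g\in G$ with $d(x,gx)\leqslant\varepsilon$ and $d(y,gy)\leqslant\varepsilon$. An element $g\in G$ is elliptic with respect to $X$ if the orbits of $\langle g\rangle$ on $\Gamma(G,X)$ are bounded, and loxodromic with respect to $X$ if $n\mapsto g^nx$ is a quasi-isometric embedding $\mathbb{Z}\to\Gamma(G,X)$ for some (equivalently, any) $x$. For loxodromic $g$, $E_G(g)=\{f\in G\mid \exists\, n\in\mathbb{N}: f^{-1}g^nf=g^{\pm n}\}$ (the unique maximal virtually cyclic subgroup containing $g$). *)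

(* Defs.v *)
From HB Require Import structures.
From mathcomp Require Import all_boot all_order all_algebra.
From mathcomp Require Import boolp classical_sets cardinality reals.
Set Implicit Arguments.
Unset Strict Implicit.
Unset Printing Implicit Defensive.
Import Order.TTheory GRing.Theory Num.Theory.
Local Open Scope classical_set_scope.
Local Open Scope ring_scope.

(** * Words and word length *)

Definition word_for (G : groupType) (X : set G) (g : G) (s : seq G) : Prop :=
  [set` s] `<=` X /\ (\prod_(x <- s) x = g)%g.

(* Generating sets are symmetric and possibly infinite; because of symmetry,
   words in [X] need no formal inverses. *)
Definition generating_set (G : groupType) (X : set G) : Prop :=
  (forall x, X x -> X x^-1%g) /\ (forall g, exists s, word_for X g s).

(* For a generating set the minimum exists; the default value 0 of [xget] is
   only returned on elements that are not represented by any word. *)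
Definition word_length (G : groupType) (X : set G) (g : G) : nat :=
  xget 0%N [set n | (exists2 s, word_for X g s & size s = n) /\
                    (forall s, word_for X g s -> (n <= size s)%N)].

Definition expgz (G : groupType) (g : G) (k : int) : G :=
  match k with Posz n => (g ^+ n)%g | Negz n => (g ^- n.+1)%g end.

(** * Metric notions

    The function [d] below is a distance which may vanish on distinct points
    (several triples represent the same point of the Cayley graph). All the
    notions depend only on the metric space obtained by identifying points at
    distance 0. *)

Section Metric.
Context {R : realType} {T : Type}.
Variable d : T -> T -> R.

Definition geodesic (x y : T) (l : R) (f : R -> T) : Prop :=
  [/\ 0 <= l, f 0 = x, f l = y &
      forall s t, 0 <= s <= l -> 0 <= t <= l -> d (f s) (f t) = `|s - t|].

(* Rips' condition. It is stated for one side of the triangle only, since the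
   three sides are cyclically permuted by permuting [x], [y], [z]. Connected
   graphs are geodesic spaces, so this is not made part of the definition. *)
Definition hyperbolic : Prop :=
  exists2 delta : R, 0 <= delta &
    forall (x y z : T) (l1 l2 l3 : R) (f1 f2 f3 : R -> T),
      geodesic x y l1 f1 -> geodesic y z l2 f2 -> geodesic z x l3 f3 ->
      forall s, 0 <= s <= l1 ->
        (exists2 t, 0 <= t <= l2 & d (f1 s) (f2 t) <= delta) \/
        (exists2 t, 0 <= t <= l3 & d (f1 s) (f3 t) <= delta).

Definition bounded_subset (A : set T) : Prop :=
  exists B : R, forall y z, A y -> A z -> d y z <= B.

Definition qi_embedding_int (f : int -> T) : Prop :=
  exists lambda c : R, [/\ 1 <= lambda, 0 <= c &
    forall m n : int,
      `|m%:~R - n%:~R| / lambda - c <= d (f m) (f n)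
        <= lambda * `|m%:~R - n%:~R| + c].

Variables (G : groupType) (act : G -> T -> T).

Definition acylindrical : Prop :=
  forall eps : R, 0 < eps ->
    exists (r : R) (N : nat), [/\ 0 < r, (0 < N)%N &
      forall x y, r <= d x y ->
        ([set g | d x (act g x) <= eps /\ d y (act g y) <= eps] #<= `I_N)%card].

Definition elliptic (g : G) : Prop :=
  forall x, bounded_subset (range (fun k : int => act (expgz g k) x)).

Definition loxodromic (g : G) : Prop :=
  exists x, qi_embedding_int (fun k : int => act (expgz g k) x).

End Metric.

(** * The Cayley graph as a metric graph *)

(* Edges of length 1 join distinct vertices [a], [b] with [a^-1 b] in [X]
   (an edge and its reverse are the same geometric edge, loops are dropped).
   The triple [(a, b, t)] is the point at distance [t] from [a] on the edge
   joining [a] to [b]; [(a, a, 0)] is the vertex [a]. *)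
Section CayleyGraph.
Context {G : groupType}.
Variables (R : realType) (X : set G).

Definition cayley_point_axiom (a b : G) (t : R) : Prop :=
  (a = b /\ t = 0) \/ [/\ a <> b, X (a^-1 * b)%g & 0 <= t <= 1].

Record cayley_point := CayleyPoint {
  cp_src : G;
  cp_tgt : G;
  cp_pos : R;
  cp_axiom : cayley_point_axiom cp_src cp_tgt cp_pos }.

Lemma cayley_act_axiom (g : G) (p : cayley_point) :
  cayley_point_axiom (g * cp_src p)%g (g * cp_tgt p)%g (cp_pos p).
Proof.
case: p => a b t /= [[-> ->]|[ab Xab t01]]; [by left|right; split=> //].
  by move=> /mulgI.
by rewrite invgM -mulgA mulKg.
Qed.

Definition cayley_act (g : G) (p : cayley_point) : cayley_point :=
  CayleyPoint (cayley_act_axiom g p).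

Definition word_dist (a b : G) : R := (word_length X (a^-1 * b)%g)%:R.

(* The length of a shortest path leaving both edges through an endpoint. *)
Definition dist_via_vertices (p q : cayley_point) : R :=
  let: CayleyPoint a b s _ := p in
  let: CayleyPoint a' b' t _ := q in
  Num.min
    (Num.min (s + word_dist a a' + t) (s + word_dist a b' + (1 - t)))
    (Num.min (1 - s + word_dist b a' + t) (1 - s + word_dist b b' + (1 - t))).

Definition cayley_dist (p q : cayley_point) : R :=
  if (cp_src p == cp_src q) && (cp_tgt p == cp_tgt q) then
    `|cp_pos p - cp_pos q|
  else if (cp_src p == cp_tgt q) && (cp_tgt p == cp_src q) then
    `|cp_pos p - (1 - cp_pos q)|
  else dist_via_vertices p q.

End CayleyGraph.

Definition hyperbolic_cayley (R : realType) (G : groupType) (X : set G) : Prop :=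
  hyperbolic (@cayley_dist G R X).

Definition acylindrical_cayley (R : realType) (G : groupType) (X : set G) : Prop :=
  acylindrical (@cayley_dist G R X) (@cayley_act G R X).

Definition elliptic_wrt (R : realType) (G : groupType) (X : set G) (g : G) : Prop :=
  elliptic (@cayley_dist G R X) (@cayley_act G R X) g.

Definition loxodromic_wrt (R : realType) (G : groupType) (X : set G) (g : G) : Prop :=
  loxodromic (@cayley_dist G R X) (@cayley_act G R X) g.

Definition E_G (G : groupType) (g : G) : set G :=
  [set f | exists2 n : nat, (0 < n)%N &
     (f^-1 * g ^+ n * f = g ^+ n)%g \/ (f^-1 * g ^+ n * f = g ^- n)%g].

(* Main.v *)
Require Import Defs.
From HB Require Import structures.
From mathcomp Require Import all_boot all_order all_algebra.
From mathcomp Require Import boolp classical_sets cardinality reals.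
From mathcomp Require Import zify lra.
Set Implicit Arguments.
Unset Strict Implicit.
Unset Printing Implicit Defensive.
Import Order.TTheory GRing.Theory Num.Theory.

(** Let [d] be the word metric, [|g| = d 1 g], and suppose that [L = |c^n e|]
    is small compared with [n]. Then [e] carries [1] to a point at distance [L]
    from [c^-n], so the geodesic from [1] to [e] follows the axis of [c] along
    most of its length. An element with bounded orbits acts on the geodesic
    from [1] to its image like a reflection in the midpoint
    ([bounded_orbit_square]); hence [e] reverses a long piece of the axis
    ([axis_flip]). As [c^k] translates the axis, the elements
    [e^-1 c^k e c^k] for [k <= N] nearly fix two points that are far apart
    ([far_points_commuted]). Acylindricity makes two of these elements equal,
    and [c^k e c^k = c^l e c^l] says that [e] conjugates [c^(l-k)] to its
    inverse, so that [e] lies in [E_G c]. For bounded [n] the inequality only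
    asks for [c^n e <> 1], which holds because powers of [c] lie in [E_G c].

    The bound has to be uniform in [c], whereas the orbit of [c] is a
    quasi-geodesic with constants depending on [c]. The axis of [c] is
    therefore represented by a geodesic from [c^-K] to [c^K], where [K] is
    huge, depending on [c], [e] and [n]. Its middle part is translated by
    [c^k] by the amount [T k = |c^(K+k)| - |c^K|], which is additive in [k] up
    to the hyperbolicity constant ([shift_add], [translate_coordinates]). The
    uniform growth of [T] comes from acylindricity: the set of points moved by
    at most [eps] by each of [c], ..., [c^N] is invariant under [c], so it is
    empty or has infinite diameter, and the latter is impossible when [N] is
    large in terms of [eps] only ([displacement_unbounded]). Hence
    [T i > delta] for some [i <= N], and near-additivity makes [T] grow at
    least linearly ([shift_linear]).

    All estimates use the four-point inequality for the integer-valued word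
    metric, obtained from slim triangles ([slim_four_point]). The Cayley graph
    enters through the lift of discrete geodesics ([path_point_geodesic]) and
    the fact that a point of an edge is close to the origin of the edge
    ([cayley_dist_src]). *)

Local Open Scope nat_scope.

(** * Invariant integer-valued metrics on groups *)

Lemma E_G_of_palindrome_eq (G : groupType) (c e : G) k l : k < l ->
  (c ^+ k * (e * c ^+ k) = c ^+ l * (e * c ^+ l))%g -> E_G c e.
Proof.
move=> ltkl; have [m m_gt0 ->] : exists2 m, 0 < m & l = k + m.
  by exists (l - k); lia.
rewrite {2}addnC !expgnDr => eq; exists m => //; right.
have {eq} eE : e = (c ^+ m * (e * c ^+ m))%g.
  apply: (@mulIg _ (c ^+ k)%g); apply: (@mulgI _ (c ^+ k)%g).
  by rewrite eq !mulgA.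
by apply: (@mulIg _ (c ^+ m)%g); rewrite mulVg -!mulgA -eE mulVg.
Qed.

Section Metric.
Variables (G : groupType) (d : G -> G -> nat).

Record invariant_metric : Prop := InvariantMetric {
  metric_refl : forall x, d x x = 0;
  metric_eq0 : forall x y, d x y = 0 -> x = y;
  metric_sym : forall x y, d x y = d y x;
  metric_triangle : forall x y z, d x z <= d x y + d y z;
  metric_inv : forall g x y, d (g * x)%g (g * y)%g = d x y }.

Definition nat_geodesic (x y : G) (p : nat -> G) : Prop :=
  [/\ p 0 = x, p (d x y) = y &
      forall i j, i <= j -> j <= d x y -> d (p i) (p j) = j - i].

(** One side only, as the three sides are permuted cyclically by permuting
    the vertices. *)
Definition slim_triangles (delta : nat) : Prop :=
  forall x y z p q r, nat_geodesic x y p -> nat_geodesic y z q ->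
    nat_geodesic z x r -> forall i, i <= d x y ->
    (exists2 j, j <= d y z & d (p i) (q j) <= delta) \/
    (exists2 j, j <= d z x & d (p i) (r j) <= delta).

(** Gromov hyperbolicity in Gromov-product-free form: of the three ways of
    pairing four points, the two largest sums differ by at most [delta]. *)
Definition four_point (delta : nat) : Prop :=
  forall x y z w, d x y + d z w <= maxn (d x z + d y w) (d x w + d y z) + delta.

Hypothesis dm : invariant_metric.

Lemma geodesic_between x y p i : nat_geodesic x y p -> i <= d x y ->
  d x (p i) = i /\ d (p i) y = d x y - i.
Proof.
case=> p0 pl pij il; split; first by rewrite -[in d x _]p0 pij // subn0.
by rewrite -[in d _ y]pl pij.
Qed.

Section Slim.
Variable delta : nat.
Hypothesis geo : forall x y, exists p, nat_geodesic x y p.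
Hypothesis slim : slim_triangles delta.

(** A point of the side [x y] near both other sides is at distance about the
    Gromov product of [x] and [y] from [z]: both detours through it are almost
    geodesic. Such a point exists because the side starts near one of the other
    sides and ends near the other one. *)
Lemma gromov_product_witness x y z p : nat_geodesic x y p ->
  exists2 i, i <= d x y &
    d x y + 2 * d z (p i) <= d x z + d z y + 4 * delta.+1.
Proof.
have S := metric_sym dm.
move=> gp; have [q gq] := geo y z; have [r gr] := geo z x.
have gpi := geodesic_between gp.
pose nearr i := exists2 j, j <= d z x & d (p i) (r j) <= delta.
pose nearq i := exists2 j, j <= d y z & d (p i) (q j) <= delta.
suff [i ixy [[j jr Hr] [k kq Hq]]] : exists2 i, i <= d x y &
    (exists2 j, j <= d z x & d (p i) (r j) <= delta.+1) /\
    (exists2 j, j <= d y z & d (p i) (q j) <= delta.+1).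
  exists i => //; have [] := gpi _ ixy; have [] := geodesic_between gr jr.
  have [] := geodesic_between gq kq.
  have := metric_triangle dm x (r j) (p i).
  have := metric_triangle dm z (r j) (p i).
  have := metric_triangle dm z (q k) (p i).
  have := metric_triangle dm (p i) (q k) y.
  move: (S (p i) (r j)) (S (p i) (q k)) (S x z) (S y z) (S x (r j)).
  by move: (S y (q k)) (S z (q k)); lia.
have [p0 pl pd] := gp.
have r0 : nearr 0.
  exists (d z x) => //; have [_ -> _] := gr.
  by rewrite p0 (metric_refl dm).
have ql : nearq (d x y).
  by exists 0 => //; have [-> _ _] := gq; rewrite pl (metric_refl dm).
have weaken A (n : nat) (f : nat -> G) b :
    (exists2 j, j <= b & d A (f j) <= n) ->
    exists2 j, j <= b & d A (f j) <= n.+1.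
  by case=> j jb le; exists j => //; exact: leqW.
(* Somewhere the side passes from being near one side to being near the
   other one. *)
have [i ilt [ri [qi|[lti qi]]]] : exists2 i, i <= d x y &
    nearr i /\ (nearq i \/ i < d x y /\ nearq i.+1).
  have : forall m, m <= d x y -> nearr m \/ exists2 i, i <= d x y &
      nearr i /\ (nearq i \/ i < d x y /\ nearq i.+1).
    elim=> [_|m IH mlt]; first by left.
    have [rm|] := IH (ltnW mlt); last by right.
    have [qm|rm'] := slim gp gq gr mlt; last by left.
    by right; exists m; [exact: ltnW|split=> //; right].
  by case/(_ _ (leqnn _)) => // rl; exists (d x y) => //; split=> //; left.
- by exists i => //; split; apply: weaken.
- exists i => //; split; first exact: weaken.
  case: qi => j jl qi; exists j => //.
  have := metric_triangle dm (p i) (p i.+1) (q j).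
  by rewrite pd //; lia.
Qed.

(** Take the point [p i] of the side [x y] that realizes the Gromov product
    seen from [w]. By slimness it is near one of the sides [y z], [z x], so the
    Gromov product of that pair seen from [w] is not much larger. *)
Lemma slim_four_point : four_point (6 * delta + 4).
Proof.
move=> x y z w; have S := metric_sym dm.
have [p gp] := geo x y; have [q gq] := geo y z; have [r gr] := geo z x.
have [i il Hw] := gromov_product_witness w gp.
have [[j jl Hj]|[j jl Hj]] := slim gp gq gr il.
- have [] := geodesic_between gq jl.
  have := metric_triangle dm w (p i) (q j).
  have := metric_triangle dm w (q j) y.
  have := metric_triangle dm w (q j) z.
  by move: (S w x) (S w y) (S w z) (S (q j) y); lia.
- have [] := geodesic_between gr jl.
  have := metric_triangle dm w (p i) (r j).
  have := metric_triangle dm w (r j) x.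
  have := metric_triangle dm w (r j) z.
  by move: (S w x) (S w y) (S w z) (S (r j) z) (S x z); lia.
Qed.
End Slim.

Definition escapes (c : G) : Prop :=
  forall M, exists n0, forall n, n0 <= n -> M < d 1%g (c ^+ n)%g.

Definition bounded_orbit (e : G) : Prop :=
  exists B, forall n, d 1%g (e ^+ n)%g <= B.

(** [N + 1] elements that almost fix two distant points cannot be distinct.
    Families indexed by [nat] spare the use of cardinals. *)
Definition acylindrical_nat : Prop :=
  forall eps, exists r N, forall x y (g : nat -> G), r <= d x y ->
    (forall i, i <= N -> d x (g i * x)%g <= eps /\ d y (g i * y)%g <= eps) ->
    exists i j, [/\ i < j, j <= N & g i = g j].

Lemma escapes_inj c i j : escapes c -> (c ^+ i = c ^+ j)%g -> i = j.
Proof.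
move=> esc; wlog ltij : i j / i < j => [H cij|cij].
  by case: (ltngtP i j) => // lt; [exact: H|symmetry; exact: H].
have c1 : (c ^+ (j - i) = 1)%g.
  by apply: (@mulgI _ (c ^+ i)%g); rewrite mulg1 -expgnDr subnKC // ltnW.
have [n0 H] := esc 0; have := H ((j - i) * n0).
by rewrite leq_pmull ?subn_gt0 // expgnA c1 expg1n (metric_refl dm) => /(_ isT).
Qed.

Lemma displacement_lower x g : d 1%g g <= 2 * d 1%g x + d x (g * x)%g.
Proof.
have E : d (g * x)%g g = d x 1%g by rewrite -[in RHS](metric_inv dm g) mulg1.
have := metric_triangle dm 1%g x g; have := metric_triangle dm x (g * x)%g g.
by rewrite E (metric_sym dm x 1%g); lia.
Qed.

(** If [c], ..., [c^N] all moved [x] by at most [eps], they would move every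
    [c^m x] by the same amounts, since they commute with [c^m]; as the orbit of
    [c] is unbounded, this contradicts acylindricity. The point is that [N]
    depends on [eps] alone. *)
Lemma displacement_unbounded : acylindrical_nat ->
  forall eps, exists N, forall c, escapes c -> forall x,
    exists i, [/\ 0 < i, i <= N & eps < d x (c ^+ i * x)%g].
Proof.
move=> acyl eps; have [r [N H]] := acyl eps; exists N => c esc x.
apply: contrapT => no.
have small i : i <= N -> d x (c ^+ i * x)%g <= eps.
  case: i => [|i] iN; first by rewrite expg0 mul1g (metric_refl dm).
  by rewrite leqNgt; apply/negP => lt; apply: no; exists i.+1.
have [n0 far] := esc (r + 2 * d 1%g x).
have rx : r <= d x (c ^+ n0 * x)%g.
  rewrite -(leq_add2l (2 * d 1%g x)) addnC.
  exact: leq_trans (ltnW (far _ (leqnn _))) (displacement_lower _ _).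
have [|i [j [ltij jN cij]]] := H _ _ (fun i => c ^+ i)%g rx.
  move=> i iN; split; first exact: small.
  by rewrite mulgA -expgnDr addnC expgnDr -mulgA (metric_inv dm) small.
by have := escapes_inj esc cij; lia.
Qed.

(** The minimum of the lengths of [c^n] over all late times [n] is attained.
    Starting from such a time makes the shifts of the axis nonnegative, which
    fixes the direction of translation. *)
Lemma record_time c M : escapes c -> exists K,
  [/\ M <= K, M < d 1%g (c ^+ K)%g, M < d 1%g (c ^+ (K + K))%g &
      forall k, d 1%g (c ^+ K)%g <= d 1%g (c ^+ (K + k))%g].
Proof.
move=> esc; have [n0 H] := esc M; pose n1 := maxn n0 M.
have exP : exists m, `[< exists2 n, n1 <= n & m = d 1%g (c ^+ n)%g >].
  by exists (d 1%g (c ^+ n1)%g); apply/asboolP; exists n1.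
have [m /asboolP[K n1K ->] min] := ex_minnP exP.
exists K; split=> [|||k]; [lia|apply: H; lia|apply: H; lia|].
by apply: min; apply/asboolP; exists (K + k) => //; lia.
Qed.

Section Hyperbolic.
Variable delta : nat.
Hypothesis hyp : four_point delta.

Lemma power_four_point (c : G) (a := fun k => d 1%g (c ^+ k)%g) m n l :
  a (m + n) + a (n + l) <= maxn (a m + a l) (a n + a (m + n + l)) + delta /\
  a n + a (m + n + l) <= maxn (a m + a l) (a (m + n) + a (n + l)) + delta.
Proof.
pose p k : G := (c ^+ k)%g.
have pE i j : d (p i) (p (i + j)) = a j.
  by rewrite /p expgnDr -[X in d X _]mulg1 (metric_inv dm).
have H1 := hyp 1%g (p (m + n)) (p m) (p (m + n + l)).
have H2 := hyp 1%g (p (m + n + l)) (p m) (p (m + n)).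
move: H1 H2; rewrite !(metric_sym dm (p (m + n + l)) (p _)).
rewrite (metric_sym dm (p (m + n)) (p m)) !pE.
rewrite -(addnA m n l) pE (addnA m n l) -!/(a _).
by lia.
Qed.

(** The four-point inequality for [1, e, e^2, e^(n+2)] shows that if [e^2] were
    longer than [e] by more than [delta], the lengths of the powers of [e]
    would increase strictly. *)
Lemma bounded_orbit_square e : bounded_orbit e ->
  d e^-1%g e <= d 1%g e + delta.
Proof.
case=> B bB; rewrite leqNgt; apply/negP => big.
pose b n := d 1%g (e ^+ n)%g.
have {}big : b 1 + delta < b 2.
  suff -> : b 2 = d e^-1%g e by [].
  by rewrite -[RHS](metric_inv dm e) mulgV.
have rec n : b n <= b n.+1 -> b n.+1 < b n.+2.
  by have [] := power_four_point e 1 1 n; rewrite -!/(b _) !addSn !add0n; lia.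
have incr n : n <= b n.+1 /\ b n.+1 < b n.+2.
  elim: n => [|n [nb lt]]; first by split=> //; lia.
  by have := rec _ (ltnW lt); split=> //; lia.
by have := bB B.+2; rewrite -/(b _); have [] := incr B.+1; lia.
Qed.

(** ** The axis of an element with unbounded orbits *)

Section Axis.
Variables (c : G) (K P A : nat).
Let pw k : G := (c ^+ k)%g.
Let a k := d 1%g (pw k).
Let u : G := (c ^- K)%g.
Let v : G := pw K.
Hypothesis aP : forall k, k <= P -> a k <= A.
Hypothesis PK : P <= K.
Hypothesis aK : A + delta < a K.
Hypothesis aK_min : forall k, a K <= a (K + k).

(* The amount by which [pw k] translates the axis, read off from the Busemann
   function of the end [u]. *)
Let T k := a (K + k) - a K.

Let pwM m n : (pw m * pw n)%g = pw (m + n).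
Proof. by rewrite /pw expgnDr. Qed.

Let dpp m n : d (pw m) (pw (m + n)) = a n.
Proof. by rewrite -pwM -[X in d X _]mulg1 (metric_inv dm). Qed.

Let dup n : d u (pw n) = a (K + n).
Proof. by rewrite -(metric_inv dm (pw K)) mulgV pwM. Qed.

Let duv : d u v = a (K + K).
Proof. exact: dup. Qed.

Let atri m n : a (m + n) <= a m + a n.
Proof. by have := metric_triangle dm 1%g (pw m) (pw (m + n)); rewrite dpp. Qed.

Let four m n l :
  a (m + n) + a (n + l) <= maxn (a m + a l) (a n + a (m + n + l)) + delta /\
  a n + a (m + n + l) <= maxn (a m + a l) (a (m + n) + a (n + l)) + delta.
Proof. exact: power_four_point. Qed.

(** The four points [1, c^m, c^(m+K), c^(m+K+n)]: since [K] is large, the sum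
    [a m + a n] cannot be one of the two largest. *)
Lemma shift_add m n : m + n <= P ->
  T (m + n) <= T m + T n + delta /\ T m + T n <= T (m + n) + delta.
Proof.
move=> mnP; have [] := four m K n; rewrite (addnC m K) -(addnA K m n).
have : a m <= A by apply: aP; lia.
have : a n <= A by apply: aP; lia.
rewrite /T; have := aK_min m; have := aK_min n; have := aK_min (m + n); lia.
Qed.

Lemma shift_le k : k <= P -> T k <= A.
Proof. by move=> kP; have := aP kP; have := atri K k; rewrite /T; lia. Qed.

Lemma shift_mul m n : m * n <= P ->
  T (m * n) <= m * (T n + delta) /\ m * T n <= T (m * n) + m * delta.
Proof.
elim: m => [|m IH mnP]; first by rewrite /T !mul0n addn0 subnn.
have [] := IH (leq_trans (leq_mul (leqnSn m) (leqnn n)) mnP).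
by have [] := @shift_add n (m * n) mnP; rewrite !mulSn; lia.
Qed.

(** [T (m * n)] is close to both [m * T n] and [n * T m]. *)
Lemma shift_compare m n : m * n <= P ->
  m * T n <= n * (T m + delta) + m * delta.
Proof.
move=> mnP; have [_ H] := shift_mul mnP.
have [|H' _] := @shift_mul n m; first by rewrite mulnC.
by rewrite mulnC in H'; lia.
Qed.

Lemma shift_back k : k <= P ->
  a (K - k) + T k <= a K + delta /\ a K <= a (K - k) + T k + delta.
Proof.
move=> kP; have kK := leq_trans kP PK.
have [] := four k (K - k) k; rewrite (subnK kK) (subnKC kK).
have := aP kP; rewrite /T; have := aK_min k; lia.
Qed.

(** Moving [x] by [c^k] is moving the end [u] by [c^-k]. Seen from [x] or from
    [1], this changes the distance to the end by the same amount up to [delta],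
    provided that [x] is not too far from [1]: the bound on [d 1 x] excludes
    the third pairing of the four points. The same holds for the end [v]. *)
Lemma translate_coordinates x k : k <= P ->
  2 * d 1%g x + 2 * A + delta < 2 * a K ->
  [/\ d u (pw k * x)%g <= d u x + T k + delta,
      d u x + T k <= d u (pw k * x)%g + delta,
      d v (pw k * x)%g + T k <= d v x + 2 * delta &
      d v x <= d v (pw k * x)%g + T k + 2 * delta].
Proof.
move=> kP xc; have kK := leq_trans kP PK.
have [b1 b2] := shift_back kP; have ak := aP kP.
pose u' : G := (c ^- (K + k))%g; pose v' := pw (K - k).
have du : d u (pw k * x)%g = d u' x.
  rewrite -[RHS](metric_inv dm (pw k)); congr (d _ _).
  by rewrite /u' expgnDr invgM mulgA mulgV mul1g.
have dv : d v (pw k * x)%g = d v' x.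
  by rewrite -[RHS](metric_inv dm (pw k)) pwM subnKC.
have pwu' : (pw (K + k) * u' = 1)%g by exact: mulgV.
have pwu : (pw K * u = 1)%g by exact: mulgV.
have u'1 : d u' 1%g = a (K + k).
  by rewrite -(metric_inv dm (pw (K + k))) pwu' mulg1.
have u1 : d u 1%g = a K.
  by rewrite -(metric_inv dm (pw K)) pwu mulg1.
have u'u : d u' u = a k.
  by rewrite -(metric_inv dm (pw (K + k))) pwu' addnC -pwM -mulgA pwu mulg1.
have v1 : d v 1%g = a K by rewrite (metric_sym dm).
have v'1 : d v' 1%g = a (K - k) by rewrite (metric_sym dm).
have v'v : d v' v = a k by rewrite -(dpp (K - k) k) subnK.
rewrite du dv.
have := (hyp u' x u 1%g); have := hyp u x u' 1%g.
have := (hyp v' x v 1%g); have := hyp v x v' 1%g.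
rewrite (metric_sym dm u u') (metric_sym dm v v') u'1 u1 u'u v1 v'1 v'v.
have := metric_triangle dm u' x 1%g; have := metric_triangle dm v' x 1%g.
have := metric_triangle dm u x 1%g; have := metric_triangle dm v x 1%g.
rewrite u'1 u1 v1 v'1 (metric_sym dm x 1%g).
have := atri (K - k) k; rewrite subnK //.
have : T k + a K = a (K + k) by have := aK_min k; rewrite /T; lia.
move: (metric_sym dm x u) (metric_sym dm x u') (metric_sym dm x v).
move: (metric_sym dm x v') b1 b2.
move: (T k) => t *; split; lia.
Qed.

Variable gam : nat -> G.
Let D := a (K + K).
Hypothesis gamP : nat_geodesic u v gam.

Let gam_u j : j <= D -> d u (gam j) = j.
Proof. by rewrite /D -duv => /(geodesic_between gamP)[]. Qed.

Let gam_v j : j <= D -> d v (gam j) = D - j.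
Proof.
by rewrite (metric_sym dm) /D -duv => /(geodesic_between gamP)[].
Qed.

Let u1 : d u 1%g = a K. Proof. by rewrite (dup 0) addn0. Qed.
Let v1 : d v 1%g = a K. Proof. by rewrite (metric_sym dm). Qed.

(** Up to [delta], the distance of [x] to a point of the geodesic is determined
    by the distances of [x] to the two ends. *)
Lemma dist_axis x j : j <= D ->
  d x (gam j) + D <= maxn (d u x + (D - j)) (d v x + j) + delta.
Proof.
move=> jD; have := hyp x (gam j) u v.
have := gam_u jD; have := gam_v jD; rewrite duv -/D.
by move: (metric_sym dm x u) (metric_sym dm x v)
  (metric_sym dm (gam j) u) (metric_sym dm (gam j) v); lia.
Qed.

Lemma axis_near j : 2 * j <= D -> d 1%g (gam j) + j <= a K + delta.
Proof.
move=> jD; have := @dist_axis 1%g j; rewrite u1 v1.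
by move=> /(_ ltac:(lia)); lia.
Qed.

Lemma axis_shift k j : k <= P -> A + 2 * delta < j -> 2 * j <= D ->
  j + T k <= D -> d (pw k * gam j)%g (gam (j + T k)) <= 3 * delta.
Proof.
move=> kP jA jD jT; have near := axis_near jD.
have [|h1 h2 h3 h4] := @translate_coordinates (gam j) k kP; first lia.
have := dist_axis (pw k * gam j)%g jT.
have := @gam_u j; have := @gam_v j.
by move=> /(_ ltac:(lia)) ? /(_ ltac:(lia)) ?; lia.
Qed.

Section Flip.
Variable e : G.
Hypothesis e2 : d e^-1%g e <= d 1%g e + delta.
Let b := d 1%g e.
Let Ue := d u e.
Let Ve := d v e.
Hypothesis UVe : Ue + delta < Ve.

(** By [UVe] the point [e] projects to the axis nearer to [u] than [1] does, so
    the geodesic from [1] to [e] follows the axis in between. *)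
Lemma length_via_axis : a K + Ve <= b + D + delta.
Proof.
have := hyp u 1%g v e; rewrite (metric_sym dm 1%g v) u1 v1 duv.
rewrite -/D -/Ve -/Ue -/b.
by move: UVe; rewrite -/Ue -/Ve; lia.
Qed.

(** The point [gam j] lies near the geodesic from [1] to [e], in its half near
    [1]. Its image lies near the geodesic from [e] to [e^2], in the half near
    [e]; there that geodesic runs along the one from [e] back to [1], because
    [d 1 (e^2)] is at most about [d 1 e]. So [e * gam j] is near the point of
    the axis at the mirror position [j']. *)
Lemma axis_flip j j' : j + j' + Ve = a K + D -> j' <= j -> 2 * j <= D ->
  Ue + D <= 2 * j' + Ve -> d (e * gam j)%g (gam j') <= 6 * delta.
Proof.
move=> jj' j'j jD j'U.
have bl := length_via_axis.
have n1 := axis_near jD; have n2 := @axis_near j' ltac:(lia).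
have n3 := @dist_axis e j ltac:(lia); have n4 := @dist_axis e j' ltac:(lia).
rewrite -/Ue -/Ve in n3 n4.
set w := (e * gam j)%g.
have we : d w e = d 1%g (gam j).
  by rewrite (metric_sym dm) -(metric_inv dm e 1%g) mulg1.
have we2 : d w (e * e)%g = d e (gam j).
  by rewrite (metric_inv dm) (metric_sym dm).
have ee : d e (e * e)%g = b.
  by rewrite /b -(metric_inv dm e 1%g) mulg1.
have e1 : d 1%g (e * e)%g = d e^-1%g e.
  by rewrite -[RHS](metric_inv dm e) mulgV.
have h1 := hyp w 1%g e (e * e)%g.
have h2 := hyp w (gam j') 1%g e.
rewrite ee e1 we we2 in h1; rewrite we -/b in h2.
have e2' : d e^-1%g e <= b + delta := e2.
move: (metric_sym dm (gam j') 1%g) (metric_sym dm (gam j') e).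
lia.
Qed.

(** The four moves take the position [j] to [j + T k], to the mirror position
    [j' - T k], to [j'], and back to [j]. Each translation costs [3 * delta]
    and each reflection [6 * delta]. *)
Lemma axis_commute k j j' : k <= P ->
  j + j' + Ve = a K + D -> j' <= j -> 2 * (j + T k) <= D ->
  Ue + D + 2 * T k <= 2 * j' + Ve -> A + 2 * delta + T k < j' ->
  d (gam j) (e^-1 * (pw k * (e * (pw k * gam j))))%g <= 18 * delta.
Proof.
move=> kP jj' j'j jT j'T j'A.
have s1 := @axis_shift k j kP ltac:(lia) ltac:(lia) ltac:(lia).
have f1 := @axis_flip (j + T k) (j' - T k)
  ltac:(lia) ltac:(lia) ltac:(lia) ltac:(lia).
have s2 := @axis_shift k (j' - T k) kP ltac:(lia) ltac:(lia) ltac:(lia).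
have f2 := @axis_flip j j' ltac:(lia) ltac:(lia) ltac:(lia) ltac:(lia).
rewrite subnK in s2; last lia.
rewrite -(metric_inv dm e) mulVKg.
apply: leq_trans (metric_triangle dm _ (gam j') _) _.
rewrite (metric_sym dm (gam j')).
have t1 := metric_triangle dm (pw k * (e * (pw k * gam j)))%g
  (pw k * gam (j' - T k))%g (gam j').
have t2 := metric_triangle dm (e * (pw k * gam j))%g (e * gam (j + T k))%g
  (gam (j' - T k)).
rewrite (metric_inv dm) in t2; rewrite (metric_inv dm) in t1.
lia.
Qed.
End Flip.

(** Uniform growth: [T i > delta] for some [i <= N], as [pw i] moves the middle
    of the geodesic by about [T i]; then [n * T i <= i * T n] up to the error
    in [shift_compare]. *)
Lemma shift_linear N n : 2 * (2 * A + 2 * delta + 1) < D ->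
  (exists i, [/\ 0 < i, i <= N &
     4 * delta < d (gam D./2) (pw i * gam D./2)%g]) ->
  N <= P -> N * n <= P -> n <= N * (T n + delta).
Proof.
move=> DA [i [i0 iN far]] NP NnP.
have [Dh Dh'] : 2 * D./2 <= D /\ D <= 2 * D./2 + 1 by lia.
have iP : i <= P by lia.
have TiA := shift_le iP.
have sh := @axis_shift i D./2 iP ltac:(lia) Dh ltac:(lia).
have gT : d (gam D./2) (gam (D./2 + T i)) = T i.
  have [_ _ g] := gamP; rewrite g; [lia|lia|].
  by rewrite duv -/D; lia.
have tri := metric_triangle dm (gam D./2) (gam (D./2 + T i))
  (pw i * gam D./2)%g.
rewrite (metric_sym dm (gam (D./2 + T i))) in tri.
have Ti : delta < T i by lia.
have inP : i * n <= P by apply: leq_trans NnP; rewrite leq_mul2r iN orbT.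
have cmp : n * T i <= i * (T n + delta) + n * delta.
  by apply: shift_compare; rewrite mulnC.
have big : n * delta.+1 <= n * T i by rewrite leq_mul2l Ti orbT.
have : i * (T n + delta) <= N * (T n + delta) by rewrite leq_mul2r iN orbT.
by rewrite mulnS in big; lia.
Qed.

(** If [pw n * e] is short, then [e] projects to the axis about [T n] before
    [1] does. The admissible positions [j] then fill an interval of length
    about [T n / 2], so two of them at distance [r] leave room for the shifts
    by [T k]. *)
Lemma far_points_commuted e n N r :
  d e^-1%g e <= d 1%g e + delta -> n <= P -> N <= P ->
  2 * d 1%g e + 2 * A + 4 * delta < D ->
  (forall k, k <= N ->
     d 1%g (pw n * e)%g + 2 * r + 2 * T k + delta < T n) ->
  exists x y, r <= d x y /\ forall k, k <= N ->
    d x (e^-1 * (pw k * (e * (pw k * x))))%g <= 18 * delta /\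
    d y (e^-1 * (pw k * (e * (pw k * y))))%g <= 18 * delta.
Proof.
move=> e2 nP NP Db Tn.
set L := d 1%g (pw n * e)%g in Tn.
have LE : d (c ^- n)%g e = L by rewrite -(metric_inv dm (pw n)) mulgV.
have un : d u (c ^- n)%g = a (K - n).
  rewrite -(metric_inv dm (pw n)) mulgV (metric_sym dm) /u.
  rewrite -(metric_inv dm (pw (K - n))) mulg1 mulgA.
  by rewrite pwM subnK ?(leq_trans nP PK) // mulgV (metric_sym dm).
have vn : d v (c ^- n)%g = a (K + n).
  rewrite (metric_sym dm) -(metric_inv dm (pw n)) mulgV.
  by rewrite pwM addnC.
have [sb1 sb2] := shift_back nP.
have aKn : a (K + n) = a K + T n by have := aK_min n; rewrite /T; lia.
have t1 := metric_triangle dm u (c ^- n)%g e.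
have t2 := metric_triangle dm v e (c ^- n)%g.
rewrite (metric_sym dm e (c ^- n)%g) in t2.
rewrite LE un in t1; rewrite LE vn in t2.
have t3 := metric_triangle dm u e 1%g; have t4 := metric_triangle dm v 1%g e.
rewrite (metric_sym dm e 1%g) u1 in t3; rewrite v1 in t4.
have T0 := Tn 0 isT.
have comm := @axis_commute e e2 ltac:(lia).
(* [m] is twice the position of the centre of the reflection. *)
pose m := a K + D - d v e; pose j := uphalf m; pose j' := m - j.
have [j1 j2] : m <= 2 * j /\ 2 * j <= m + 1.
  by rewrite /j; lia.
have mE : m + d v e = a K + D by rewrite /m; lia.
have jj' : j + j' = m by rewrite /j'; lia.
exists (gam (j + r)), (gam j); split.
  rewrite (metric_sym dm); have [_ _ g] := gamP.
  rewrite g; [lia|lia|rewrite duv -/D].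
  by lia.
move=> k kN; have := Tn k kN => Tk; split.
- by apply: (comm k (j + r) (j' - r)); lia.
- by apply: (comm k j j'); lia.
Qed.
End Axis.

(** ** Powers times elements with bounded orbits *)

(** The constants: one of [c], ..., [c^M] moves a given point by more than
    [4 * delta], so that [T n] is at least about [n / M]; at most [N] elements
    move two points at distance [r] by at most [18 * delta]. For [n >= n0] the
    bounds [T n >= n / M - delta] and [L <= n / (4 * M)] leave the room that
    [far_points_commuted] asks for, and [n >= 8 * N] makes [T k] at most about
    an eighth of [T n] for [k <= N]. *)
Theorem power_times_bounded_length :
  (forall x y, exists p, nat_geodesic x y p) -> acylindrical_nat ->
  exists Q, forall c e n, escapes c -> bounded_orbit e -> ~ E_G c e ->
    0 < n -> n < Q * d 1%g (c ^+ n * e)%g.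
Proof.
move=> geo acyl.
have [M lox] := displacement_unbounded acyl (4 * delta).
have [r [N few]] := acyl (18 * delta).
pose n0 := M * (4 + 8 * r + 19 * delta) + 8 * N.
exists (4 * M + n0 + 1) => c e n esc bnd nE n_gt0.
rewrite ltnNge; apply/negP => short.
pose L := d 1%g (c ^+ n * e)%g; rewrite -/L in short.
have [|n_big] := ltnP n n0.
  move=> n_small; have L0 : L = 0.
    by case: (L) short => // l; rewrite mulnS; lia.
  have eE : e = (c ^- n)%g by rewrite (mulg1_eq (esym (metric_eq0 dm L0))).
  apply: nE; exists n => //; left.
  by rewrite eE invgK mulgK.
(* [P] bounds the exponents at which shifts are compared, [A] the lengths of
   the corresponding powers of [c]. *)
pose P := N * n + M * n + N + M + n.
pose A := P * d 1%g c.
pose b := d 1%g e.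
have [K [PK aK aKK aKmin]] :=
  record_time (P + 4 * A + 4 * delta + 2 * b + 2) esc.
have aA k : k <= P -> d 1%g (c ^+ k)%g <= A.
  move=> kP; apply: (@leq_trans (k * d 1%g c)); last first.
    by rewrite leq_mul2r kP orbT.
  elim: (k) => [|i IH]; first by rewrite expg0 (metric_refl dm).
  rewrite expgSr mulSn addnC.
  apply: leq_trans (metric_triangle dm _ (c ^+ i)%g _) _.
  by apply: leq_add => //; rewrite -{1}[(c ^+ i)%g]mulg1 (metric_inv dm).
have [gam gamP] := geo (c ^- K)%g (c ^+ K)%g.
pose T k := d 1%g (c ^+ (K + k))%g - d 1%g (c ^+ K)%g.
have PK' : P <= K by lia.
have AK : A + delta < d 1%g (c ^+ K)%g by lia.
have lin : n <= M * (T n + delta).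
  apply: (@shift_linear c K P A aA PK' AK aKmin gam gamP); try lia.
  have [i [i0 iM Hi]] := lox c esc (gam (d 1%g (c ^+ (K + K))%g)./2).
  by exists i.
have M_gt0 : 0 < M by case: (M) lin; lia.
have Tk k : k <= N -> 8 * T k <= T n + 9 * delta.
  move=> kN.
  have : n * T k <= k * (T n + delta) + n * delta.
    apply: (@shift_compare c K P A aA PK' AK aKmin).
    rewrite mulnC; apply: (@leq_trans (N * n)).
      by rewrite leq_mul2r kN orbT.
    by rewrite /P; lia.
  have : 8 * (k * (T n + delta)) <= n * (T n + delta).
    by rewrite mulnA leq_mul2r; apply/orP; right; rewrite /n0 in n_big; lia.
  by move=> h1 h2; rewrite -(leq_pmul2l n_gt0); lia.
have Tbig : 4 * L + 4 + 8 * r + 16 * delta <= 3 * T n.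
  have ML : 4 * (M * L) <= n.
    by apply: leq_trans short; rewrite mulnA leq_mul2r; apply/orP; right; lia.
  by rewrite -(leq_pmul2l M_gt0); rewrite /n0 in n_big; lia.
have [||||x [y [rxy near]]] := @far_points_commuted c K P A aA PK' AK aKmin
  gam gamP e n N r (bounded_orbit_square bnd).
- by rewrite /P; lia.
- by rewrite /P; lia.
- by rewrite -/b; lia.
- by move=> k kN; have := Tk k kN; rewrite -/(T k) -/(T n) -/L; lia.
have [|k [l [ltkl lN eq]]] := few x y
  (fun k => e^-1 * (c ^+ k * (e * c ^+ k)))%g rxy.
  by move=> i iN; have [hx hy] := near i iN; rewrite -!mulgA.
exact: nE (E_G_of_palindrome_eq ltkl (mulgI _ _ _ eq)).
Qed.
End Hyperbolic.
End Metric.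

(** * The word metric *)

Section WordMetric.
Variables (G : groupType) (X : set G).
Hypothesis genX : generating_set X.

Definition word_metric (a b : G) : nat := word_length X (a^-1 * b)%g.

Lemma word_lengthP g :
  (exists2 s, word_for X g s & size s = word_length X g) /\
  (forall s, word_for X g s -> word_length X g <= size s).
Proof.
apply: (@xgetPex _ 0 [set n | (exists2 s, word_for X g s & size s = n) /\
  (forall s, word_for X g s -> n <= size s)]%classic).
have [s gs] := genX.2 g.
have exn : exists n, `[< exists2 s, word_for X g s & size s = n >].
  by exists (size s); apply/asboolP; exists s.
have [n /asboolP sn min] := ex_minnP exn; exists n; split=> // t gt.
by apply: min; apply/asboolP; exists t.
Qed.

Lemma word_length1 : word_length X 1%g = 0.
Proof.
apply/eqP; rewrite -leqn0; have [_ /(_ [::])] := word_lengthP 1%g.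
by apply; split; rewrite ?big_nil.
Qed.

Lemma word_length_eq0 g : word_length X g = 0 -> g = 1%g.
Proof.
have [[s [_ gs] <-] _] := word_lengthP g => /eqP; rewrite size_eq0 => /eqP s0.
by rewrite -gs s0 big_nil.
Qed.

Lemma word_length_eq1 g : word_length X g = 1 -> X g.
Proof.
have [[s [sX gs] <-] _] := word_lengthP g.
case: s sX gs => [|x [|y s]] //= sX gs _.
by rewrite -gs big_seq1; apply: sX; rewrite /= mem_seq1.
Qed.

Lemma word_length_gen x : X x -> word_length X x <= 1.
Proof.
move=> Xx; have [_ /(_ [:: x])] := word_lengthP x; apply; split.
  by move=> y /=; rewrite mem_seq1 => /eqP ->.
by rewrite big_seq1.
Qed.

Lemma word_lengthM g h :
  word_length X (g * h)%g <= word_length X g + word_length X h.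
Proof.
have [[s [sX gs] <-] _] := word_lengthP g.
have [[t [tX ht] <-] _] := word_lengthP h.
rewrite -size_cat; apply: (word_lengthP _).2; split.
  by move=> x /=; rewrite mem_cat => /orP[]; [exact: sX|exact: tX].
by rewrite big_cat /= gs ht.
Qed.

Lemma word_lengthV g : word_length X g^-1%g = word_length X g.
Proof.
wlog suff le : g / word_length X g^-1%g <= word_length X g.
  by apply/eqP; rewrite eqn_leq le -{1}[g]invgK le.
have [[s [sX gs] <-] _] := word_lengthP g.
rewrite -(size_rev s) -(size_map (fun x : G => x^-1%g)).
apply: (word_lengthP _).2; split.
  move=> x /= /mapP[y]; rewrite mem_rev => ys ->.
  by apply: genX.1; apply: sX.
rewrite -gs; elim: s {sX gs} => [|x s IH]; first by rewrite !big_nil invg1.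
by rewrite rev_cons map_rcons -cats1 big_cat /= big_seq1 IH big_cons invgM.
Qed.

Lemma word_metricP : invariant_metric word_metric.
Proof.
rewrite /word_metric; split=> [x|x y|x y|x y z|g x y].
- by rewrite mulVg word_length1.
- by move/word_length_eq0 => xy; rewrite -[RHS](mulVKg x) xy mulg1.
- by rewrite -word_lengthV invgM invgK.
- by rewrite -[X in word_length _ X <= _](_ : x^-1 * y * (y^-1 * z) = _)%g
    ?word_lengthM // -mulgA mulVKg.
- by rewrite invgM -mulgA mulKg.
Qed.

Lemma word_metric_geodesic x y : exists p, nat_geodesic word_metric x y p.
Proof.
have dm := word_metricP.
have [[s [sX gs] sl] _] := word_lengthP (x^-1 * y)%g.
pose p i := (x * \prod_(z <- take i s) z)%g.
have step i j : i <= j -> j <= size s -> word_metric (p i) (p j) <= j - i.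
  move=> ij js; rewrite (metric_inv dm) -(subnKC ij) takeD big_cat /=.
  rewrite /word_metric mulKg.
  apply: leq_trans ((word_lengthP _).2 (take (j - i) (drop i s)) _) _.
    by split=> // z /mem_take /mem_drop; exact: sX.
  by rewrite size_take size_drop; case: ltnP; lia.
have p0 : p 0 = x by rewrite /p take0 big_nil mulg1.
have pl : p (size s) = y by rewrite /p take_size gs mulVKg.
exists p; rewrite /nat_geodesic {1 2}/word_metric -sl; split=> // i j ij js.
have h1 := step _ _ (leq0n i) (leq_trans ij js).
have h2 := step _ _ js (leqnn _); have h3 := step _ _ ij js.
have := metric_triangle dm x (p i) y; have := metric_triangle dm (p i) (p j) y.
have : word_metric x y = size s by rewrite sl.
by rewrite p0 in h1; rewrite pl in h2; lia.
Qed.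
End WordMetric.

Local Open Scope ring_scope.

(** * The Cayley graph as a geodesic space *)

Section CayleyGraph.
Variables (R : realType) (G : groupType) (X : set G).
Hypothesis genX : generating_set X.

Local Notation point := (cayley_point R X).
Local Notation cdist := (@cayley_dist G R X).
Local Notation wd := (word_metric X).

Let wdP := word_metricP genX.

Definition vertex (a : G) : point :=
  CayleyPoint (or_introl (conj (erefl a) (erefl (0 : R)))).

Lemma cayley_point_bounds (p : point) :
  [/\ 0 <= cp_pos p, cp_pos p <= 1 & (wd (cp_src p) (cp_tgt p) <= 1)%N].
Proof.
case: p => a b t /= [[<- ->]|[_ Xab /andP[t0 t1]]].
  by rewrite (metric_refl wdP); split=> //; exact: ler01.
by split=> //; exact: word_length_gen.
Qed.

(** Points of edges are compared with the origins of their edges, so that the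
    word metric determines all distances up to an additive error of [2]. *)
Lemma cayley_dist_src (p q : point) :
  (wd (cp_src p) (cp_src q))%:R - 2 <= cdist p q
    <= (wd (cp_src p) (cp_src q))%:R + 2.
Proof.
have [] := cayley_point_bounds p; have [] := cayley_point_bounds q.
case: p q => [a b s ps] [a' b' t qs]; rewrite /cayley_dist /=.
move=> t0 t1 ab' s0 s1 ab.
case: ifP => [/andP[/eqP -> _]|_].
  by rewrite (metric_refl wdP) mulr0n; case: (lerP t s) => *; lra.
case: ifP => [/andP[/eqP -> _]|_].
  rewrite (metric_sym wdP).
  have : ((wd a' b')%:R <= 1 :> R) by rewrite (ler_nat R _ 1).
  have := ler0n R (wd a' b').
  by case: (lerP (1 - t) s) => *; lra.
have m1 : (wd a a' <= wd a b' + 1)%N.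
  have := metric_triangle wdP a b' a'; rewrite (metric_sym wdP b' a'); lia.
have m2 : (wd a a' <= wd b a' + 1)%N by have := metric_triangle wdP a b a'; lia.
have m3 : (wd a a' <= wd b b' + 2)%N.
  have := metric_triangle wdP a b a'; have := metric_triangle wdP b b' a'.
  by rewrite (metric_sym wdP b' a'); lia.
rewrite /word_dist -!/(wd _ _).
move: m1 m2 m3; rewrite -!(ler_nat R) !natrD.
rewrite !ge_min !le_min; move=> m1 m2 m3.
apply/andP; split; last by rewrite (_ : s + _ + t <= _) //; lra.
by apply/andP; split; apply/andP; split; lra.
Qed.

Lemma cayley_distE (p q : point) : cdist p q =
  if (cp_src p == cp_src q) && (cp_tgt p == cp_tgt q) then
    `|cp_pos p - cp_pos q|
  else if (cp_src p == cp_tgt q) && (cp_tgt p == cp_src q) then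
    `|cp_pos p - (1 - cp_pos q)|
  else Num.min
    (Num.min (cp_pos p + word_dist R X (cp_src p) (cp_src q) + cp_pos q)
      (cp_pos p + word_dist R X (cp_src p) (cp_tgt q) + (1 - cp_pos q)))
    (Num.min (1 - cp_pos p + word_dist R X (cp_tgt p) (cp_src q) + cp_pos q)
      (1 - cp_pos p + word_dist R X (cp_tgt p) (cp_tgt q) + (1 - cp_pos q))).
Proof. by case: p q => [a b s ps] [a' b' t qs]. Qed.

Lemma cayley_distC p q : cdist p q = cdist q p.
Proof.
rewrite !cayley_distE; have S a b : word_dist R X a b = word_dist R X b a.
  by congr (_%:R); exact: (metric_sym wdP).
rewrite [cp_src q == cp_src p]eq_sym [cp_tgt q == cp_tgt p]eq_sym distrC.
case: ifP => // _; rewrite [cp_src q == _]eq_sym [cp_tgt q == _]eq_sym andbC.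
case: ifP => _; first by congr `|_|; lra.
rewrite minACA !(S (cp_src p)) !(S (cp_tgt p)).
by congr (Num.min (Num.min _ _) (Num.min _ _)); lra.
Qed.

Section Lift.
Variables (x y : G) (p : nat -> G).
Hypothesis gp : nat_geodesic wd x y p.
Let l := wd x y.

(** The arc-length parametrization of the discrete geodesic [p]. Integer times
    go to the vertices themselves, not to ends of edges, since the sides of a
    geodesic triangle have to share their corners as triples; the last branch
    is not reached when [p] is geodesic and [0 <= s <= l]. *)
Definition path_point (s : R) : point :=
  let i := Num.truncn s in
  if s == i%:R then vertex (p i) else
  match pselect (cayley_point_axiom X (p i) (p i.+1) (s - i%:R)) with
  | left ax => CayleyPoint ax
  | right _ => vertex (p i)
  end.

Lemma path_point_vertex i : path_point i%:R = vertex (p i).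
Proof. by rewrite /path_point natrK eqxx. Qed.


(** The alternative is between a vertex and the interior of an edge; recording
    it in terms of [p] avoids handling proofs inside points. *)
Definition on_path (P : point) (i : nat) (s : R) : Prop :=
  [/\ cp_src P = p i, cp_pos P = s &
      cp_tgt P = p i /\ s = 0 /\ (i <= l)%N \/
      cp_tgt P = p i.+1 /\ 0 < s < 1 /\ (i < l)%N].

Lemma path_pointP s : 0 <= s <= l%:R ->
  exists i t, on_path (path_point s) i t /\ s = i%:R + t.
Proof.
move=> /andP[s0 sl]; rewrite /path_point; set i := Num.truncn s.
have /andP[ile ilt] := truncn_itv s0; rewrite -/i in ile ilt.
case: eqP => [si|/eqP si].
  exists i, 0; split; last by rewrite addr0.
  by split=> //; left; rewrite -(ler_nat R) -si.
have {}ile : i%:R < s by rewrite lt_neqAle eq_sym si.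
have il : (i < l)%N by rewrite -(ltr_nat R); exact: lt_le_trans sl.
have [_ _ pd] := gp; rewrite -natr1 in ilt.
case: pselect => [ax|[]] /=.
  exists i, (s - i%:R); split; last by lra.
  by split=> //; right; split=> //; split=> //; lra.
have d1 : wd (p i) (p i.+1) = 1%N by rewrite pd // subSnn.
right; split=> [eq||].
- by move: d1; rewrite eq (metric_refl wdP).
- exact: (word_length_eq1 genX).
- by lra.
Qed.

Let dist_path i j : (i <= l)%N -> (j <= l)%N ->
  (wd (p i) (p j))%:R = `|i%:R - j%:R| :> R.
Proof.
have [_ _ pd] := gp; wlog ij : i j / (i <= j)%N => [H il jl|il jl].
  case/orP: (leq_total i j) => ij; first exact: H.
  by rewrite (metric_sym wdP) distrC H.
by rewrite pd // natrB // distrC ger0_norm // subr_ge0 ler_nat.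
Qed.

Let path_eq i j : (i <= l)%N -> (j <= l)%N -> (p i == p j) = (i == j).
Proof.
move=> il jl; apply/eqP/eqP => [pij|-> //]; have := dist_path il jl.
rewrite pij (metric_refl wdP) => /esym/eqP.
by rewrite normr_eq0 subr_eq0 eqr_nat => /eqP.
Qed.

(** For [i < j] the shortest of the four paths through end points is the one
    leaving forwards from [P] and entering [Q] from behind; for [i = j] one of
    the two points is the vertex [p i], unless both lie on the same edge. *)
Lemma on_path_dist P Q i j s t : on_path P i s -> on_path Q j t ->
  cdist P Q = `|i%:R + s - (j%:R + t)|.
Proof.
wlog ij : P Q i j s t / (i <= j)%N => [H Ps Qt|].
  by case/orP: (leq_total i j) => ij; [|rewrite cayley_distC distrC]; exact: H.
move=> [Pi Ps bi] [Qj Qt bj]; rewrite cayley_distE Pi Ps Qj Qt.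
have [i' [-> i'E i'l]] : exists i' : nat, [/\ cp_tgt P = p i',
    i' = i /\ s = 0 \/ i' = i.+1 /\ 0 < s < 1 & (i' <= l)%N].
  by case: bi => -[E [? ?]]; [exists i|exists i.+1]; split=> //; [left|right].
have [j' [-> j'E j'l]] : exists j' : nat, [/\ cp_tgt Q = p j',
    j' = j /\ t = 0 \/ j' = j.+1 /\ 0 < t < 1 & (j' <= l)%N].
  by case: bj => -[E [? ?]]; [exists j|exists j.+1]; split=> //; [left|right].
have il : (i <= l)%N by case: i'E => -[] *; lia.
have jl : (j <= l)%N by case: j'E => -[] *; lia.
rewrite !path_eq // /word_dist -!/(wd _ _) !dist_path //.
case: ifP => [/andP[/eqP -> _]|same].
  by rewrite opprD addrACA subrr add0r.
case: ifP => [/andP[/eqP ij' /eqP i'j]|_].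
  by exfalso; case: i'E j'E => -[? ?] [] [? ?]; lia.
have ijR : (i%:R <= j%:R :> R) by rewrite ler_nat.
have N1 : `|i%:R - j%:R| = j%:R - i%:R :> R by rewrite ler0_norm; lra.
have N2 : `|i%:R - (j%:R + 1)| = j%:R + 1 - i%:R :> R by rewrite ler0_norm; lra.
have N3 : `|i%:R + 1 - (j%:R + 1)| = j%:R - i%:R :> R.
  by rewrite ler0_norm; lra.
apply/eqP; rewrite eq_le !ge_min !le_min.
have [ltij|] := ltnP i j.
  have {}ltij : i%:R + 1 <= j%:R :> R by rewrite natr1 ler_nat.
  have N4 : `|i%:R + 1 - j%:R| = j%:R - (i%:R + 1) :> R.
    by rewrite ler0_norm; lra.
  have N5 : `|i%:R + s - (j%:R + t)| = j%:R + t - (i%:R + s).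
    by rewrite ler0_norm; case: i'E j'E => -[_ ?] [] [_ ?]; lra.
  by case: i'E j'E => -[-> ?] [] [-> ?];
    rewrite -?natr1 ?(N1, N2, N3, N4, N5); lra.
move=> ji; have {ji ij} eqij : i = j by lia.
subst j; have N4 : `|i%:R + 1 - i%:R| = 1 :> R by rewrite ger0_norm; lra.
have N5 : `|i%:R + s - (i%:R + t)| = s + t.
  case: i'E j'E same => -[-> ?] [] [-> ?]; rewrite ?eqxx // => _.
  - by rewrite ler0_norm; lra.
  - by rewrite ger0_norm; lra.
case: i'E j'E same => -[-> ?] [] [-> ?]; rewrite ?eqxx // => _.
all: by rewrite -?natr1 ?(N1, N2, N3, N4, N5); lra.
Qed.

Lemma path_point_geodesic :
  geodesic cdist (vertex x) (vertex y) l%:R path_point.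
Proof.
have [p0 pl _] := gp; split; rewrite ?ler0n //.
- by rewrite (path_point_vertex 0) p0.
- by rewrite path_point_vertex pl.
move=> s t /path_pointP[i [s' [Ps sE]]] /path_pointP[j [t' [Qt tE]]].
by rewrite (on_path_dist Ps Qt) -sE -tE.
Qed.
End Lift.
End CayleyGraph.

(** * From the Cayley graph to the word metric *)

Section Transfer.
Variables (R : realType) (G : groupType) (X : set G).
Hypothesis genX : generating_set X.

Local Notation cdist := (@cayley_dist G R X).
Local Notation wd := (word_metric X).
Let wdP := word_metricP genX.

Lemma wd_le_dist p q : (wd (cp_src p) (cp_src q))%:R <= cdist p q + 2.
Proof. by have := cayley_dist_src genX p q; lra. Qed.

Lemma dist_le_wd p q : cdist p q <= (wd (cp_src p) (cp_src q))%:R + 2.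
Proof. by have := cayley_dist_src genX p q; lra. Qed.

(** Lift the three sides to the graph, apply the condition there and return to
    the origins of the edges. *)
Lemma hyperbolic_slim : hyperbolic_cayley R X ->
  exists delta, slim_triangles wd delta.
Proof.
case=> delta delta0 rips; exists (Num.truncn delta + 3)%N.
move=> x y z p q r gp gq gr i il.
have near (a b : G) (f : nat -> G) : nat_geodesic wd a b f ->
    (exists2 t, 0 <= t <= (wd a b)%:R &
      cdist (path_point X p i%:R) (path_point X f t) <= delta) ->
    exists2 j, (j <= wd a b)%N & (wd (p i) (f j) <= Num.truncn delta + 3)%N.
  move=> gf [t /(path_pointP genX gf)[j [s [[srcE _ jl] _]]] le].
  exists j; first by case: jl => -[_ [_ ?]] //; exact: ltnW.
  have := wd_le_dist (path_point X p i%:R) (path_point X f t).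
  rewrite srcE path_point_vertex /= in le *; move=> le'.
  rewrite -ltnS -(ltr_nat R) -addnS natrD; have := truncnS_gt delta.
  by rewrite -(natr1 (Num.truncn delta)); lra.
have := rips _ _ _ _ _ _ _ _ _ (path_point_geodesic R genX gp)
  (path_point_geodesic R genX gq) (path_point_geodesic R genX gr) i%:R.
rewrite ler0n ler_nat il => /(_ isT)[]; [left|right]; exact: near.
Qed.

Lemma acylindrical_word_metric : acylindrical_cayley R X ->
  acylindrical_nat wd.
Proof.
move=> acyl eps; have [|r [N [r0 N0 few]]] := acyl (eps%:R + 2).
  by rewrite ltr_wpDl ?ler0n.
exists (Num.truncn r + 3)%N, N => x y g rxy small.
have far : r <= cdist (vertex R X x) (vertex R X y).
  have := wd_le_dist (vertex R X x) (vertex R X y) => /=.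
  have := truncnS_gt r; move: rxy.
  by rewrite -(ler_nat R) natrD -(natr1 (Num.truncn _)); lra.
apply: contrapT => no; have {}few := few _ _ far.
suff : (`I_N.+1 #<= `I_N)%card by rewrite card_le_II ltnn.
apply: card_le_trans few.
have inj : {in `I_N.+1 &, injective g}.
  move=> i j; rewrite !inE /= => iN jN gij.
  by case: (ltngtP i j) => // ij; exfalso; apply: no; [exists i, j|exists j, i].
rewrite -(card_le_eql (inj_card_eq inj)); apply: subset_card_le.
move=> _ [i /= iN <-]; have [hx hy] := small i iN.
split; apply: le_trans (dist_le_wd _ _) _ => /=;
  by rewrite lerD2r ler_nat.
Qed.

Lemma elliptic_bounded_orbit e : elliptic_wrt R X e -> bounded_orbit wd e.
Proof.
move=> /(_ (vertex R X 1%g))[B bB]; exists (Num.truncn B + 3)%N => n.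
have := bB _ _ (ex_intro2 _ _ (Posz 0) I erefl)
  (ex_intro2 _ _ (Posz n) I erefl).
set p := cayley_act _ _; set q := cayley_act _ _ => le.
have := wd_le_dist p q; rewrite /= !mulg1 => le'.
have := truncnS_gt B; rewrite -(ler_nat R) natrD -(natr1 (Num.truncn _)); lra.
Qed.

Lemma loxodromic_escapes c : loxodromic_wrt R X c -> escapes wd c.
Proof.
case=> x [lam [k [lam1 k0 qi]]] M; pose a := cp_src x.
exists (Num.truncn (lam * (k + 2 + (2 * wd 1%g a + M)%:R))).+1 => n nbig.
have := qi 0 n%:Z => /andP[+ _].
set p := cayley_act _ _; set q := cayley_act _ _ => le.
have := dist_le_wd p q; rewrite /= mul1g -/a => le'.
have : (wd a (c ^+ n * a)%g <= 2 * wd 1%g a + wd 1%g (c ^+ n)%g)%N.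
  have := metric_triangle wdP a 1%g (c ^+ n * a)%g.
  have := metric_triangle wdP 1%g (c ^+ n)%g (c ^+ n * a)%g.
  have -> : wd (c ^+ n)%g (c ^+ n * a)%g = wd 1%g a.
    by rewrite -(metric_inv wdP (c ^+ n)%g 1%g) mulg1.
  by rewrite (metric_sym wdP a 1%g); lia.
rewrite -(ler_nat R) natrD => le''.
have lam0 : 0 < lam by lra.
have : lam * (k + 2 + (2 * wd 1%g a + M)%:R) < n%:R.
  by apply: lt_le_trans (truncnS_gt _) _; rewrite ler_nat.
rewrite mulrC -ltr_pdivlMr // natrD => lt.
rewrite /= sub0r normrN ger0_norm ?ler0n // in le.
rewrite -(ltr_nat R); lra.
Qed.
End Transfer.

(** * Linear growth of [c^n e] *)

Theorem lemma2p11 (R : realType) (G : groupType) (X : set G)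
    (genX : generating_set X)
    (hypX : hyperbolic_cayley R X) (acylX : acylindrical_cayley R X) :
  exists2 N1 : R, 0 < N1 &
    forall c : G, loxodromic_wrt R X c ->
    forall e : G, elliptic_wrt R X e -> ~ E_G c e ->
    forall n : nat, (0 < n)%N ->
      n%:R / N1 < (word_length X (c ^+ n * e)%g)%:R.
Proof.
have dm := word_metricP genX; have geo := word_metric_geodesic genX.
have [delta slim] := hyperbolic_slim genX hypX.
have [Q HQ] := power_times_bounded_length dm (slim_four_point dm geo slim)
  geo (acylindrical_word_metric genX acylX).
have Qpos : 0 < Q.+1%:R :> R by rewrite ltr0n.
exists Q.+1%:R => // c lox e ell nE n n_gt0.
rewrite ltr_pdivrMr // -natrM ltr_nat mulnC.
have := HQ c e n (loxodromic_escapes genX lox) (elliptic_bounded_orbit genX ell)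
  nE n_gt0.
rewrite /word_metric invg1 mul1g => lt; apply: leq_trans lt _.
by rewrite leq_mul2r leqnSn orbT.
Qed.
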